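(* Consider the system $x(t+1)=A_sx(t)+B_su(t)$, $y(t)=C_sx(t)+D_su(t)$ with state dimension $n$ and $m$ inputs, and assume it is minimal. Let $U_-=[u(0)\ \cdots\ u(T-1)]$, $Y_-=[y(0)\ \cdots\ y(T-1)]$ be input/output data generated by it. Assume that $k$ is such that $n<k<\tfrac12T$. Then the data $(U_-,Y_-)$ are informative for stabilization by dynamic measurement feedback if the following two conditions are satisfied: (i) $\operatorname{rank}\begin{bmatrix}\mathcal{H}_{2k}(u) \\ \mathcal{H}_{2k}(y)\end{bmatrix}=2km+n$. (ii) The input/state/output data $(\bar U_-,\bar X,\bar Y_-)$ (defined in the context) are informative for stabilization by dynamic measurement feedback. Moreover, if these conditions are satisfied, a stabilizing controller $(K,L,M)$ such that $\Sigma_{i/o}\subseteq\Sigma_{K,L,M}$ can be found as follows. Let $\bar X_-$ and $\bar X_+$ be $\bar X$ with its last, respectively first, column removed; write $\bar U_-=E\hat U_-$ with $E$ of full column rank and $\hat U_-$ of full row rank; take $\begin{bmatrix}V_1 & V_2\end{bmatrix}$ with $\begin{bmatrix}\bar X_- \\ \hat U_- \end{bmatrix}\begin{bmatrix}V_1 & V_2\end{bmatrix}=\begin{bmatrix}I & 0 \\ 0 & I\end{bmatrix}$. Then: (a) Select a matrix $\hat M$ such that $\bar X_+(V_1+V_2\hat M)$ is stable, and define $M:=E\hat M$. (b) Choose a matrix $L$ such that $(\bar X_+-L\bar Y_-)V_1$ is stable. (c) Define $K:=(\bar X_+-L\bar Y_-)(V_1+V_2\hat M)$.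
   Context: State in $\mathbb{R}^n$, input in $\mathbb{R}^m$, output in $\mathbb{R}^p$. Let $x(0),\dots,x(T)$ be the state trajectory of the system corresponding to the data. Hankel matrix of depth $\ell<T$ of a signal $f(0),\dots,f(T-1)$: $\mathcal{H}_\ell(f)$ is the block matrix with $\ell$ block rows and $T-\ell+1$ columns whose $(i,j)$ block is $f(i+j-2)$. Let $X_f=[x(k)\ \cdots\ x(T-k)]$, and let $U_p,U_f$ (resp. $Y_p,Y_f$) be the first and last $k$ block rows of $\mathcal{H}_{2k}(u)$ (resp. $\mathcal{H}_{2k}(y)$). It is known (Moonen et al.) that if the system is minimal, $n<k<\frac12T$, and $\operatorname{rank}\begin{bmatrix}\mathcal{H}_{2k}(u) \\ \mathcal{H}_{2k}(y)\end{bmatrix}=2km+n$, then the row space of $X_f$ has dimension $n$ and equals the intersection of the row spaces of $\begin{bmatrix}U_p \\ Y_p\end{bmatrix}$ and $\begin{bmatrix}U_f \\ Y_f\end{bmatrix}$. Hence from the data one obtains a matrix $\bar X=SX_f$ for some (unknown) invertible $S\in\mathbb{R}^{n\times n}$. Put $$\bar U_-=[u(k)\ \cdots\ u(T-k-1)],\quad\bar Y_-=[y(k)\ \cdots\ y(T-k-1)],\quad\bar X=S[x(k)\ \cdots\ x(T-k)].$$ A square matrix is stable if all its eigenvalues lie in the open unit disk. A dynamic controller is $w(t+1)=Kw(t)+Ly(t)$, $u(t)=Mw(t)$ with real matrices $K,L,M$ (any controller state dimension). For given $K,L,M$, $$\Sigma_{K,L,M}=\Big\{(A,B,C,D)\ \Big|\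 \begin{bmatrix}A & BM \\ LC & K+LDM\end{bmatrix}\text{ is stable}\Big\}.$$ The set of systems (with state dimension $n$; real $A,B,C,D$ of sizes $n\times n$, $n\times m$, $p\times n$, $p\times m$) consistent with the input/output data is $$\Sigma_{i/o}=\Big\{(A,B,C,D)\ \Big|\ \exists X\in\mathbb{R}^{n\times(T+1)}\text{ s.t. }\begin{bmatrix}X_+ \\ Y_- \end{bmatrix}=\begin{bmatrix}A & B \\ C & D\end{bmatrix}\begin{bmatrix}X_- \\ U_- \end{bmatrix}\Big\},$$ where $X_-$ and $X_+$ are the first $T$ and last $T$ columns of $X$. The data $(U_-,Y_-)$ are informative for stabilization by dynamic measurement feedback if there exist $K,L,M$ with $\Sigma_{i/o}\subseteq\Sigma_{K,L,M}$. The input/state/output data $(\bar U_-,\bar X,\bar Y_-)$ are informative for stabilization by dynamic measurement feedback if there exist $K,L,M$ such that every $(A,B,C,D)$ with $\begin{bmatrix}\bar X_+ \\ \bar Y_- \end{bmatrix}=\begin{bmatrix}A & B \\ C & D\end{bmatrix}\begin{bmatrix}\bar X_- \\ \bar U_- \end{bmatrix}$ belongs to $\Sigma_{K,L,M}$, where $\bar X_-$ and $\bar X_+$ are $\bar X$ with its last, respectively first, column removed. *)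

(* Defs.v *)
From HB Require Import structures.
From mathcomp Require Import all_boot all_order all_algebra.
From mathcomp Require Import classical_sets reals.
From mathcomp Require Import complex.

Set Implicit Arguments.
Unset Strict Implicit.
Unset Printing Implicit Defensive.

Import Order.TTheory GRing.Theory Num.Theory.
Local Open Scope classical_set_scope.
Local Open Scope ring_scope.

Record system (R : realType) (n m p : nat) := System {
  sysA : 'M[R]_n;
  sysB : 'M[R]_(n, m);
  sysC : 'M[R]_(p, n);
  sysD : 'M[R]_(p, m)
}.

(* The eigenvalues are complex, hence the scalar extension to R[i]. *)
Definition stable (R : realType) (n : nat) (A : 'M[R]_n) : Prop :=
  forall z : R[i], eigenvalue (map_mx (real_complex R) A) z -> `|z| < 1.

(* Signals are functions on nat; over the horizon T only u 0 .. u T.-1,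
   x 0 .. x T and y 0 .. y T.-1 are constrained. *)
Definition trajectory (R : realType) (n m p : nat) (s : system R n m p)
    (T : nat) (u : nat -> 'cV[R]_m) (x : nat -> 'cV[R]_n)
    (y : nat -> 'cV[R]_p) : Prop :=
  forall t, (t < T)%N ->
    x t.+1 = sysA s *m x t + sysB s *m u t /\
    y t = sysC s *m x t + sysD s *m u t.

(* Same input/output map from the zero initial state, equivalently same
   transfer matrix. *)
Definition io_equivalent (R : realType) (n n' m p : nat)
    (s : system R n m p) (s' : system R n' m p) : Prop :=
  forall u x y x' y',
    x 0%N = 0 -> (forall T, trajectory s T u x y) ->
    x' 0%N = 0 -> (forall T, trajectory s' T u x' y') ->
    forall t, y t = y' t.

Definition minimal (R : realType) (n m p : nat) (s : system R n m p) : Prop :=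
  forall (n' : nat) (s' : system R n' m p), io_equivalent s s' -> (n <= n')%N.

(* [f a  f (a+1)  ...  f (a+N-1)] *)
Definition window (R : realType) (q : nat) (f : nat -> 'cV[R]_q) (a N : nat) :
    'M[R]_(q, N) :=
  \matrix_(i < q, j < N) f (a + j)%N i 0.

(* Depth-l Hankel matrix of f 0, ..., f T.-1; it is meant for l < T. *)
Definition hankel (R : realType) (q l T : nat) (f : nat -> 'cV[R]_q) :
    'M[R]_(\sum_(i < l) q, (T - l).+1) :=
  \mxcol_(i < l) window f i (T - l).+1.

Definition closed_loop (R : realType) (n m p q : nat) (s : system R n m p)
    (K : 'M[R]_q) (L : 'M[R]_(q, p)) (M : 'M[R]_(m, q)) : 'M[R]_(n + q) :=
  block_mx (sysA s) (sysB s *m M)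
           (L *m sysC s) (K + L *m sysD s *m M).

Definition Sigma_KLM (R : realType) (n m p q : nat)
    (K : 'M[R]_q) (L : 'M[R]_(q, p)) (M : 'M[R]_(m, q)) :
    set (system R n m p) :=
  [set s | stable (closed_loop s K L M)].

Definition Xminus (R : realType) (n N : nat) (X : 'M[R]_(n, N.+1)) :
    'M[R]_(n, N) := col' ord_max X.

Definition Xplus (R : realType) (n N : nat) (X : 'M[R]_(n, N.+1)) :
    'M[R]_(n, N) := col' ord0 X.

Definition Sigma_iso (R : realType) (n m p N : nat)
    (U : 'M[R]_(m, N)) (X : 'M[R]_(n, N.+1)) (Y : 'M[R]_(p, N)) :
    set (system R n m p) :=
  [set s | col_mx (Xplus X) Y =
           block_mx (sysA s) (sysB s) (sysC s) (sysD s)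
             *m col_mx (Xminus X) U].

Definition Sigma_io (R : realType) (n m p N : nat)
    (U : 'M[R]_(m, N)) (Y : 'M[R]_(p, N)) : set (system R n m p) :=
  [set s | exists X : 'M[R]_(n, N.+1), Sigma_iso U X Y s].

Definition informative_iso (R : realType) (n m p N : nat)
    (U : 'M[R]_(m, N)) (X : 'M[R]_(n, N.+1)) (Y : 'M[R]_(p, N)) : Prop :=
  exists (q : nat) (K : 'M[R]_q) (L : 'M[R]_(q, p)) (M : 'M[R]_(m, q)),
    Sigma_iso U X Y `<=` Sigma_KLM (n := n) K L M.

(* The state dimension n of the candidate systems is part of the notion. *)
Definition informative_io (R : realType) (n m p N : nat)
    (U : 'M[R]_(m, N)) (Y : 'M[R]_(p, N)) : Prop :=
  exists (q : nat) (K : 'M[R]_q) (L : 'M[R]_(q, p)) (M : 'M[R]_(m, q)),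
    Sigma_io (n := n) U Y `<=` Sigma_KLM K L M.

Arguments Sigma_io {R} n {m p N} U Y.
Arguments informative_io {R} n {m p N} U Y.

(* Main.v *)
Require Import Defs.
From HB Require Import structures.
From mathcomp Require Import all_boot all_order all_algebra.
From mathcomp Require Import classical_sets reals.
From mathcomp Require Import complex ring lra zify mxred spectral.

Set Implicit Arguments.
Unset Strict Implicit.
Unset Printing Implicit Defensive.

Import Order.TTheory GRing.Theory Num.Theory.
Local Open Scope classical_set_scope.
Import Normc.
Local Open Scope ring_scope.

(** Since the Hankel matrix has rank [2km + n], it forces every consistent system
    of order [n] to be observable and its state window [x(0) ... x(T-2k)] to be
    independent of the inputs [u(0), ..., u(2k-1)]. Two consistent systems then
    have the same state window [x(k) ... x(T-k)] up to an invertible factor: each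
    window is a combination of the other one and of future inputs, and both lie in
    the span of past data, which meets that of the future inputs trivially. So
    every system consistent with the input/output data is similar to one
    consistent with the recovered input/state/output data.

    If a single controller stabilizes the affine set of the latter systems, the
    trace of any rank-one direction of this set vanishes, because traces of stable
    matrices are bounded; hence the state data are independent of the inputs and
    [V1], [V2] exist. A dynamic controller yields static gains through a Lyapunov
    factor of the closed loop, and the observer-based controller is block
    triangular in error coordinates. *)

(** * Lyapunov factors and stability *)

(** AM-GM on each product [w i * w h] and the column sums bound each square by
    [\sum_i w i ^+ 2 * t i j]; summing over [j] brings in the row sums, strict where [w i != 0]. *)
Lemma schur_test (F : realFieldType) (m n : nat) (w : 'I_m -> F)
    (t : 'I_m -> 'I_n -> F) :
  (forall i j, 0 <= t i j) ->
  (forall j, \sum_i t i j <= 1) -> (forall i, \sum_j t i j < 1) ->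
  (exists i, w i != 0) ->
  \sum_j (\sum_i w i * t i j) ^+ 2 < \sum_i w i ^+ 2.
Proof.
move=> t_ge0 col_le1 row_lt1 [i0 w_i0].
have col j : (\sum_i w i * t i j) ^+ 2 <= \sum_i w i ^+ 2 * t i j.
  have -> : (\sum_i w i * t i j) ^+ 2 =
            \sum_i \sum_h (w i * w h) * (t i j * t h j).
    rewrite expr2 mulr_suml; apply: eq_bigr => i _; rewrite mulr_sumr.
    by apply: eq_bigr => h _; ring.
  apply: (@le_trans _ _ (\sum_i \sum_h
            (w i ^+ 2 / 2 * (t i j * t h j) + w h ^+ 2 / 2 * (t i j * t h j)))).
    apply: ler_sum => i _; apply: ler_sum => h _; rewrite -mulrDl.
    apply: ler_wpM2r; first by rewrite mulr_ge0.
    by have := sqr_ge0 (w i - w h); nra.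
  under eq_bigr do rewrite big_split /=.
  rewrite big_split /= [X in _ + X]exchange_big /= -big_split /=.
  apply: ler_sum => i _; rewrite -big_split /=.
  rewrite (eq_bigr (fun h => w i ^+ 2 * t i j * t h j)); last first.
    by move=> h _; field.
  by rewrite -mulr_sumr ler_piMr // mulr_ge0 // sqr_ge0.
apply: (@le_lt_trans _ _ (\sum_j \sum_i w i ^+ 2 * t i j)).
  exact: ler_sum.
rewrite exchange_big /= (bigD1 i0) //= [ltRHS](bigD1 i0) //=.
apply: ltr_leD.
  by rewrite -mulr_sumr gtr_pMr // lt_def sqr_ge0 sqrf_eq0 w_i0.
apply: ler_sum => i _; rewrite -mulr_sumr ler_piMr ?sqr_ge0 //; exact: ltW.
Qed.

Definition sqnorm (R : realType) (N : nat) (v : 'rV[R]_N) : R :=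
  \sum_j v 0 j ^+ 2.

Lemma sqnorm_ge0 (R : realType) (N : nat) (v : 'rV[R]_N) : 0 <= sqnorm v.
Proof. by apply: sumr_ge0 => j _; apply: sqr_ge0. Qed.

Lemma sqnormE (R : realType) (N : nat) (v : 'rV[R]_N) :
  sqnorm v = (v *m v^T) 0 0.
Proof. by rewrite mxE; apply: eq_bigr => j _; rewrite mxE expr2. Qed.

Lemma sqnorm_row_mx (R : realType) (M N : nat) (v : 'rV[R]_M) (w : 'rV[R]_N) :
  sqnorm (row_mx v w) = sqnorm v + sqnorm w.
Proof. by rewrite !sqnormE tr_row_mx mul_row_col mxE. Qed.

Lemma sqnorm_proj (R : realType) (N : nat) (Pi : 'M[R]_N) (v : 'rV[R]_N) :
  Pi^T = Pi -> Pi *m Pi = Pi -> sqnorm (v *m Pi) <= sqnorm v.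
Proof.
move=> sym idem.
suff -> : sqnorm v = sqnorm (v *m Pi) + sqnorm (v - v *m Pi).
  by rewrite lerDl sqnorm_ge0.
have PP w : Pi *m (Pi *m w) = Pi *m w :> 'cV_N by rewrite mulmxA idem.
rewrite !sqnormE linearB /= trmx_mul sym mulmxBl !mulmxBr -!mulmxA !PP.
rewrite subrr subr0; move: (v *m v^T) (v *m _) => a b; rewrite !mxE; ring.
Qed.

(* Lyapunov's criterion in factored form, with Gramian [G *m G^T]. *)
Definition contractive (R : realType) (n N : nat) (A : 'M[R]_n)
    (G : 'M[R]_(n, N)) : Prop :=
  forall v : 'rV[R]_n, v != 0 -> sqnorm (v *m A *m G) < sqnorm (v *m G).

(** * Complex matrices split into real and imaginary parts *)

Section RealImaginaryParts.
Variable R : realType.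
Local Notation Re := (@complex.Re R).
Local Notation Im := (@complex.Im R).

Definition Remx m n (A : 'M[R[i]]_(m, n)) : 'M[R]_(m, n) := \matrix_(i, j) Re (A i j).
Definition Immx m n (A : 'M[R[i]]_(m, n)) : 'M[R]_(m, n) := \matrix_(i, j) Im (A i j).

Lemma ReD (a b : R[i]) : Re (a + b) = Re a + Re b. Proof. by case: a b => ? ? []. Qed.
Lemma ImD (a b : R[i]) : Im (a + b) = Im a + Im b. Proof. by case: a b => ? ? []. Qed.

Lemma Re_sum (I : finType) (f : I -> R[i]) : Re (\sum_i f i) = \sum_i Re (f i).
Proof. by elim/big_rec2: _ => // i a b _ <-; rewrite ReD. Qed.

Lemma Im_sum (I : finType) (f : I -> R[i]) : Im (\sum_i f i) = \sum_i Im (f i).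
Proof. by elim/big_rec2: _ => // i a b _ <-; rewrite ImD. Qed.

Lemma Remx_mulr m n p (A : 'M[R[i]]_(m, n)) (B : 'M[R]_(n, p)) :
  Remx (A *m map_mx (real_complex R) B) = Remx A *m B.
Proof.
apply/matrixP => i j; rewrite !mxE Re_sum; apply: eq_bigr => h _; rewrite !mxE.
by case: (A i h) => a b /=; ring.
Qed.

Lemma Immx_mulr m n p (A : 'M[R[i]]_(m, n)) (B : 'M[R]_(n, p)) :
  Immx (A *m map_mx (real_complex R) B) = Immx A *m B.
Proof.
apply/matrixP => i j; rewrite !mxE Im_sum; apply: eq_bigr => h _; rewrite !mxE.
by case: (A i h) => a b /=; ring.
Qed.

Lemma Remx_mull m n p (A : 'M[R]_(m, n)) (B : 'M[R[i]]_(n, p)) :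
  Remx (map_mx (real_complex R) A *m B) = A *m Remx B.
Proof.
apply/matrixP => i j; rewrite !mxE Re_sum; apply: eq_bigr => h _; rewrite !mxE.
by case: (B h j) => a b /=; ring.
Qed.

Lemma Immx_mull m n p (A : 'M[R]_(m, n)) (B : 'M[R[i]]_(n, p)) :
  Immx (map_mx (real_complex R) A *m B) = A *m Immx B.
Proof.
apply/matrixP => i j; rewrite !mxE Im_sum; apply: eq_bigr => h _; rewrite !mxE.
by case: (B h j) => a b /=; ring.
Qed.

Lemma Remx_scale m n (a : R[i]) (A : 'M[R[i]]_(m, n)) :
  Remx (a *: A) = Re a *: Remx A - Im a *: Immx A.
Proof. by apply/matrixP => i j; rewrite !mxE; case: a (A i j) => ? ? []. Qed.

Lemma Immx_scale m n (a : R[i]) (A : 'M[R[i]]_(m, n)) :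
  Immx (a *: A) = Re a *: Immx A + Im a *: Remx A.
Proof.
by apply/matrixP => i j; rewrite !mxE; case: a (A i j) => a b [c d] /=; ring.
Qed.

(** With [v] and [w] the real and imaginary parts of a complex row, this is multiplicativity of the
    squared norm under the scalar [a]. *)
Lemma sqnorm_complex_scale N (a : R[i]) (v w : 'rV[R]_N) :
  sqnorm (Re a *: v - Im a *: w) + sqnorm (Re a *: w + Im a *: v) =
  (Re a ^+ 2 + Im a ^+ 2) * (sqnorm v + sqnorm w).
Proof.
rewrite /sqnorm -!big_split mulr_sumr /=; apply: eq_bigr => j _; rewrite !mxE.
ring.
Qed.

Lemma normc_lt1 (a : R[i]) : (`|a| < 1) = (Re a ^+ 2 + Im a ^+ 2 < 1).
Proof.
by rewrite -(@expr_lt1 _ 2) // -add_Re2_Im2 -(ltcR _ 1).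
Qed.

End RealImaginaryParts.

(** For the real and imaginary parts of a left eigenvector, [A] scales the sum of the two squared
    norms by the squared modulus of [z], while contractivity makes that sum drop. *)
Lemma contractive_stable (R : realType) (n N : nat) (A : 'M[R]_n)
    (G : 'M[R]_(n, N)) : contractive A G -> stable A.
Proof.
move=> ctrG z /eigenvalueP [v vA v_neq0]; rewrite normc_lt1.
have reA : Remx v *m A = complex.Re z *: Remx v - complex.Im z *: Immx v.
  by rewrite -Remx_mulr vA Remx_scale.
have imA : Immx v *m A = complex.Re z *: Immx v + complex.Im z *: Remx v.
  by rewrite -Immx_mulr vA Immx_scale.
have weak w : sqnorm (w *m A *m G) <= sqnorm (w *m G).
  have [-> | w_neq0] := eqVneq w 0; first by rewrite !mul0mx.
  exact/ltW/ctrG.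
have : sqnorm (Remx v *m A *m G) + sqnorm (Immx v *m A *m G) <
       sqnorm (Remx v *m G) + sqnorm (Immx v *m G).
  have [re0 | re_neq0] := eqVneq (Remx v) 0; last first.
    by apply: ltr_leD => //; apply: ctrG.
  have [im0 | im_neq0] := eqVneq (Immx v) 0; last first.
    by apply: ler_ltD => //; apply: ctrG.
  case/eqP: v_neq0; apply/matrixP => i j; move/matrixP/(_ i j): re0.
  by move/matrixP/(_ i j): im0; rewrite !mxE; case: (v i j) => a b /= -> ->.
rewrite reA imA mulmxBl mulmxDl -!scalemxAl sqnorm_complex_scale.
set s := sqnorm _ + _ => lt_s.
have s_gt0 : 0 < s.
  rewrite lt_def addr_ge0 ?sqnorm_ge0 // andbT.
  by apply: contraTneq lt_s => ->; rewrite mulr0 ltxx.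
by rewrite gtr_pMl in lt_s.
Qed.

(** The product of the gaps [1 - f i] is a positive lower bound of each gap. *)
Lemma exists_scale (R : realFieldType) (I : finType) (f : I -> R) (c : R) :
  (forall i, 0 <= f i < 1) -> 0 <= c ->
  exists2 e : R, 0 < e <= 1 & forall i, f i + e * c < 1.
Proof.
move=> f01 c_ge0; pose d := \prod_i (1 - f i).
have fac i : 0 < 1 - f i <= 1 by have := f01 i; lra.
have d_gt0 : 0 < d by apply: prodr_gt0 => i _; have := fac i; lra.
have d_le i : d <= 1 - f i.
  rewrite /d (bigD1 i) //= ler_piMr //; first by have := fac i; lra.
  by apply: prodr_ile1 => j _; have := fac j; lra.
have d_le1 : d <= 1 by apply: prodr_ile1 => j _; have := fac j; lra.
have c1_gt0 : 0 < 1 + c by lra.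
exists (d / (1 + c)).
  by rewrite divr_gt0 //= ler_pdivrMr // mul1r; lra.
move=> i; suff : d / (1 + c) * c < d by have := d_le i; lra.
by rewrite mulrAC ltr_pdivrMr //; nra.
Qed.

Lemma trig_eigenvalue (F : fieldType) (n : nat) (A : 'M[F]_n) (i : 'I_n) :
  is_trig_mx A -> eigenvalue A (A i i).
Proof.
move=> /char_poly_trig chA; rewrite eigenvalue_root_char chA.
rewrite -(big_map (fun i => A i i) xpredT (fun a => 'X - a%:P)) root_prod_XsubC.
by apply: map_f; rewrite mem_index_enum.
Qed.

Lemma eigenvalue_similar (F : fieldType) (n : nat) (A B P : 'M[F]_n) (a : F) :
  P \in unitmx -> A *m P = P *m B -> eigenvalue B a -> eigenvalue A a.
Proof.
move=> Pu AP /eigenvalueP [v vB v_neq0]; apply/eigenvalueP.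
exists (v *m invmx P).
  by rewrite -[A](mulmxK Pu) AP !mulmxA mulmxKV // vB scalemxAl.
by apply: contraNneq v_neq0 => v0; rewrite -(mulmxKV Pu v) v0 mul0mx.
Qed.

Lemma normc_sqr (R : realType) (z : R[i]) :
  normc z ^+ 2 = complex.Re z ^+ 2 + complex.Im z ^+ 2.
Proof. by case: z => a b; rewrite /= sqr_sqrtr // addr_ge0 ?sqr_ge0. Qed.

Lemma normc_ge0 (R : realType) (z : R[i]) : 0 <= normc z.
Proof. by case: z => a b; rewrite /= sqrtr_ge0. Qed.

Lemma normc_sum (R : realType) (I : finType) (f : I -> R[i]) :
  normc (\sum_i f i) <= \sum_i normc (f i).
Proof.
elim/big_rec2: _ => [|i a b _ le_ba]; first by rewrite normc0.
exact: (le_trans (le_normcD _ _)) (lerD _ _).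
Qed.

Lemma normc_real (R : realType) (a : R) : 0 <= a -> normc a%:C%C = a.
Proof. by move=> a_ge0; rewrite /= expr0n /= addr0 sqrtr_sqr ger0_norm. Qed.

(** Schur triangularization puts the eigenvalues, of modulus below 1, on the diagonal; conjugation
    by powers of a small [e] then shrinks the other entries. *)
Lemma stable_conj_small (R : realType) (n : nat) (A : 'M[R]_n) :
  stable A -> exists W T : 'M[R[i]]_n,
    [/\ W \in unitmx, map_mx (real_complex R) A *m W = W *m T,
        forall i, \sum_j normc (T i j) < 1 &
        forall j, \sum_i normc (T i j) < 1].
Proof.
case: n A => [|n] A stA.
  exists 1%:M, 1%:M; split=> [||[]|[]] //; first exact: unitmx1.
  by rewrite [LHS]flatmx0 [RHS]flatmx0.
set Ac := map_mx (real_complex R) A.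
have [P /unitarymx_unit Pu trigT] := Schur Ac (ltn0Sn n).
have [T AcP {}trigT] : exists2 T, Ac *m invmx P = invmx P *m T & is_trig_mx T.
  rewrite /similar_to conjumx // in trigT; exists (P *m Ac *m invmx P) => //.
  by rewrite -mulmxA mulKmx.
have diagT i : 0 <= normc (T i i) < 1.
  rewrite normc_ge0 /= -(ltcR _ 1); apply: stA.
  apply: eigenvalue_similar AcP _; first by rewrite unitmx_inv.
  exact: trig_eigenvalue.
pose c := \sum_i \sum_j normc (T i j).
have c_ge0 : 0 <= c by do 2!apply: sumr_ge0 => ? _; exact: normc_ge0.
have [e /andP [e_gt0 e_le1] le_e] := exists_scale diagT c_ge0.
(* Above the diagonal the truncated [i - j] is 0, harmlessly, since [T] vanishes there. *)
pose t (i j : 'I_n.+1) := normc (T i j) * e ^+ (i - j).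
have t_ge0 i j : 0 <= t i j by rewrite mulr_ge0 ?normc_ge0 ?exprn_ge0 // ltW.
have t_diag i : t i i = normc (T i i) by rewrite /t subnn mulr1.
have t_le i j : i != j -> t i j <= normc (T i j) * e.
  move=> neq_ij; have [lt_ij | le_ji] := ltnP i j.
    by rewrite /t (is_trig_mxP trigT) // normc0 !mul0r.
  rewrite ler_wpM2l ?normc_ge0 // -[leRHS]expr1 ler_wiXn2l ?(ltW e_gt0) //.
  by rewrite subn_gt0 ltn_neqAle le_ji andbT eq_sym.
have row_c i : \sum_j normc (T i j) <= c.
  rewrite /c [leRHS](bigD1 i) //= lerDl.
  by do 2!apply: sumr_ge0 => ? _; exact: normc_ge0.
have col_c j : \sum_i normc (T i j) <= c.
  rewrite /c exchange_big [leRHS](bigD1 j) //= lerDl.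
  by do 2!apply: sumr_ge0 => ? _; exact: normc_ge0.
have row_lt1 i : \sum_j t i j < 1.
  apply: le_lt_trans (le_e i); rewrite (bigD1 i) //= t_diag lerD2l.
  apply: (@le_trans _ _ (\sum_(j | j != i) normc (T i j) * e)).
    by apply: ler_sum => j; rewrite eq_sym; exact: t_le.
  rewrite -mulr_suml mulrC ler_wpM2l ?(ltW e_gt0) // (le_trans _ (row_c i)) //.
  by rewrite [leRHS](bigD1 i) //= lerDr normc_ge0.
have col_lt1 j : \sum_i t i j < 1.
  apply: le_lt_trans (le_e j); rewrite (bigD1 j) //= t_diag lerD2l.
  apply: (@le_trans _ _ (\sum_(i | i != j) normc (T i j) * e)).
    by apply: ler_sum => i; exact: t_le.
  rewrite -mulr_suml mulrC ler_wpM2l ?(ltW e_gt0) // (le_trans _ (col_c j)) //.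
  by rewrite [leRHS](bigD1 j) //= lerDr normc_ge0.
pose D : 'M_n.+1 := diag_mx (\row_j (e ^- j)%:C%C).
pose T' : 'M_n.+1 := \matrix_(i, j) (T i j * (e ^+ (i - j))%:C%C).
have TD : T *m D = D *m T'.
  apply/matrixP => i j; rewrite mul_diag_mx mul_mx_diag !mxE.
  have [lt_ij | le_ji] := ltnP i j.
    by rewrite (is_trig_mxP trigT) // !mul0r mulr0.
  rewrite mulrCA -rmorphM /=; congr (_ * _%:C%C).
  have -> : e ^+ i = e ^+ (i - j) * e ^+ j by rewrite -exprD subnK.
  by field; rewrite !expf_neq0 // gt_eqF.
have T'E i j : normc (T' i j) = t i j.
  by rewrite mxE normcM normc_real // exprn_ge0 // ltW.
have Du : D \in unitmx.
  rewrite unitmxE det_diag unitfE.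
  apply/prodf_neq0 => j _; rewrite mxE fmorph_eq0 invr_eq0 expf_neq0 //.
  by rewrite gt_eqF.
pose W := invmx P *m D.
have Wu : W \in unitmx by rewrite unitmx_mul unitmx_inv Pu.
have AcW : Ac *m W = W *m T' by rewrite /W mulmxA AcP -!mulmxA TD.
exists W, T'; split=> // [i|j].
  by rewrite (eq_bigr (t i)).
by rewrite (eq_bigr (t^~ j)).
Qed.

(** With [G] made of the real and imaginary parts of [W], [sqnorm (v *m G)] is the squared norm of
    the complex row [v *m W], on which [A] acts as [T]; the Schur test applies to the moduli of the
    entries of [T]. *)
Lemma stable_contractive (R : realType) (n : nat) (A : 'M[R]_n) :
  stable A -> exists (N : nat) (G : 'M[R]_(n, N)), contractive A G.
Proof.
move=> /stable_conj_small [W [T [Wu AW row_lt1 col_lt1]]].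
exists (n + n)%N, (row_mx (Remx W) (Immx W)) => v v_neq0.
have sqE (B : 'M[R[i]]_n) : sqnorm (v *m row_mx (Remx B) (Immx B)) =
    \sum_j normc ((map_mx (real_complex R) v *m B) 0 j) ^+ 2.
  rewrite mul_mx_row sqnorm_row_mx -Remx_mull -Immx_mull -big_split /=.
  by apply: eq_bigr => j _; rewrite !mxE normc_sqr.
rewrite -(mulmxA v) mul_mx_row -Remx_mull -Immx_mull AW.
rewrite [ltRHS]sqE [ltLHS]sqE mulmxA.
have : map_mx (real_complex R) v *m W != 0.
  apply: contraNneq v_neq0 => w0; have : map_mx (real_complex R) v = 0.
    by rewrite -(mulmxK Wu (map_mx _ v)) w0 mul0mx.
  by move=> v0; apply/eqP/rowP => j; have /rowP/(_ j) := v0; rewrite !mxE => -[].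
move: (map_mx _ v *m W) => w /rV0Pn [i wi].
apply: (@le_lt_trans _ _ (\sum_j (\sum_i normc (w 0 i) * normc (T i j)) ^+ 2)).
  apply: ler_sum => j _; rewrite lerXn2r ?nnegrE ?normc_ge0 //.
    by apply: sumr_ge0 => h _; rewrite mulr_ge0 ?normc_ge0.
  rewrite mxE (le_trans (normc_sum _)) //; apply: ler_sum => h _.
  by rewrite normcM.
apply: schur_test => // [h j|j|]; [exact: normc_ge0 | exact: ltW |].
by exists i; apply: contraNneq wi => /eq0_normc ->.
Qed.

Lemma stable_similar (R : realType) (n : nat) (A B P : 'M[R]_n) :
  P \in unitmx -> A *m P = P *m B -> stable A -> stable B.
Proof.
move=> Pu AP stA z Bz; apply: stA.
apply: (@eigenvalue_similar _ _ _ (map_mx _ B) (map_mx (real_complex R) P)) Bz.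
  by rewrite map_unitmx.
by rewrite -!map_mxM AP.
Qed.

Lemma stable_trmx (R : realType) (n : nat) (A : 'M[R]_n) :
  stable A -> stable A^T.
Proof.
move=> stA z; rewrite -map_trmx => Atz; apply: stA; move: Atz.
rewrite !eigenvalue_root_char /char_poly -det_tr; congr (root (\det _) z).
by apply/matrixP => i j; rewrite !mxE eq_sym.
Qed.

Lemma stable_ublock (R : realType) (n q : nat) (A : 'M[R]_n)
    (B : 'M[R]_(n, q)) (D : 'M[R]_q) :
  stable A -> stable D -> stable (block_mx A B 0 D).
Proof.
move=> stA stD z; rewrite map_block_mx map_mx0 => /eigenvalueP [v].
rewrite -[v]hsubmxK mul_row_block mulmx0 addr0 scale_row_mx.
move=> /eq_row_mx [vA vD] v_neq0.
have [v0 | v1_neq0] := eqVneq (lsubmx v) 0; last first.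
  by apply: stA; apply/eigenvalueP; exists (lsubmx v).
rewrite v0 mul0mx add0r in vD; apply: stD; apply/eigenvalueP.
by exists (rsubmx v) => //; apply: contraNneq v_neq0 => ->; rewrite v0 row_mx0.
Qed.

(** The trace is the sum of the [n] complex roots of the characteristic polynomial, all in the unit
    disk. *)
Lemma stable_trace (R : realType) (n : nat) (A : 'M[R]_n) :
  stable A -> `|\tr A| <= n%:R.
Proof.
case: n A => [|n] A stA; first by rewrite /mxtrace big_ord0 normr0.
set Ac := map_mx (real_complex R) A.
have [rs chE] := closed_field_poly_normal (char_poly Ac).
rewrite (monicP (char_poly_monic _)) scale1r in chE.
have size_rs : size rs = n.+1.
  by have := size_char_poly Ac; rewrite chE size_prod_XsubC => -[].
have rs_lt1 z : z \in rs -> `|z| <= 1.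
  move=> z_rs; apply/ltW/stA.
  by rewrite eigenvalue_root_char chE root_prod_XsubC.
have trE : \tr Ac = \sum_(z <- rs) z.
  apply: oppr_inj; rewrite -char_poly_trace // chE -[n.+1]size_rs.
  by rewrite coefPn_prod_XsubC // size_rs.
rewrite -(lecR _ _); have -> : (`|\tr A|%:C)%C = `|\tr Ac|.
  by rewrite trace_map_mx normc_def /= expr0n addr0 sqrtr_sqr.
rewrite trE rmorph_nat (le_trans (ler_norm_sum _ _ _)) //.
rewrite -size_rs -sum1_size natr_sum big_seq [leRHS]big_seq.
by apply: ler_sum => z; exact: rs_lt1.
Qed.

Lemma stable_affine_trace (R : realType) (n : nat) (A0 A1 : 'M[R]_n) :
  (forall a, stable (A0 + a *: A1)) -> \tr A1 = 0.
Proof.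
move=> st; apply/eqP; apply: contraT => tr_neq0.
(* This [a] makes the trace of [A0 + a *: A1] at least [n + 1], above the bound for stable
   matrices. *)
pose a := (n%:R + 1 + `|\tr A0|) / \tr A1.
have := stable_trace (st a); rewrite mxtraceD mxtraceZ divfK //.
have := normr_ge0 (\tr A0); have := lerB_normD (n%:R + 1 + `|\tr A0|) (\tr A0).
rewrite [`|_ + _ + _|]ger0_norm ?addr_ge0 //.
rewrite (addrC (\tr A0)); lra.
Qed.

Lemma gram_unit (R : realType) (n N : nat) (G : 'M[R]_(n, N)) :
  (forall v : 'rV_n, v != 0 -> 0 < sqnorm (v *m G)) -> G *m G^T \in unitmx.
Proof.
move=> G_pos; rewrite -row_free_unit; apply/inj_row_free => v vG0.
apply/eqP; apply: contraT => /G_pos.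
by rewrite sqnormE trmx_mul mulmxA -(mulmxA v) vG0 mul0mx mxE ltxx.
Qed.

(* With [G1], [G2] the row blocks of a Lyapunov factor of the closed loop,
   the feedback is chosen so that [v *m (A + B *m F) *m G1] is the orthogonal
   projection on the row space of [G1] of the closed-loop image of [v]. *)
Lemma dynamic_to_static (R : realType) (n q r : nat) (A : 'M[R]_n)
    (B : 'M[R]_(n, r)) (M : 'M[R]_(r, q)) (N : 'M[R]_(q, n)) (K : 'M[R]_q) :
  stable (block_mx A (B *m M) N K) -> exists F, stable (A + B *m F).
Proof.
move=> /stable_contractive [d [G]]; rewrite -[G]vsubmxK.
move: (usubmx G) (dsubmx G) => G1 G2 {G} ctrG.
have col_neq0 (v : 'rV[R]_n) : v != 0 -> row_mx v 0 != 0 :> 'rV_(n + q).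
  by move=> v_neq0; rewrite -(row_mx0 _ 1 n q); apply: contraNneq v_neq0 => /eq_row_mx [->].
(* Test vectors with zero controller part see only the first block row of the closed loop. *)
have lt_G1 (v : 'rV[R]_n) : v != 0 ->
    sqnorm (v *m (A *m G1 + B *m M *m G2)) < sqnorm (v *m G1).
  move=> /col_neq0 /ctrG.
  rewrite mul_row_block !mul_row_col !mul0mx !addr0.
  by rewrite mulmxDr !mulmxA.
set P := G1 *m G1^T.
have Pu : P \in unitmx.
  by apply: gram_unit => v /lt_G1; apply: le_lt_trans; exact: sqnorm_ge0.
pose Pi := G1^T *m invmx P *m G1.
have G1Pi : G1 *m Pi = G1 by rewrite /Pi !mulmxA mulmxV // mul1mx.
have Pi_sym : Pi^T = Pi.
  by rewrite /Pi !trmx_mul trmx_inv trmx_mul trmxK mulmxA.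
have Pi_idem : Pi *m Pi = Pi by rewrite {1}/Pi -mulmxA G1Pi.
pose F := M *m G2 *m G1^T *m invmx P.
exists F; apply: (@contractive_stable _ _ _ _ G1) => v v_neq0.
have -> : v *m (A + B *m F) *m G1 = v *m (A *m G1 + B *m M *m G2) *m Pi.
  rewrite -!(mulmxA v); congr (v *m _).
  by rewrite !mulmxDl -(mulmxA A) G1Pi /F /Pi !mulmxA.
exact: le_lt_trans (sqnorm_proj _ Pi_sym Pi_idem) (lt_G1 _ v_neq0).
Qed.

(** * Input/state/output data *)

Section InputStateOutput.
Context {R : realType} {n m p N : nat}.
Variables (U : 'M[R]_(m, N)) (X : 'M[R]_(n, N.+1)) (Y : 'M[R]_(p, N)).

Lemma Sigma_isoP (s : system R n m p) :
  Sigma_iso U X Y s <->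
  Xplus X = sysA s *m Xminus X + sysB s *m U /\
  Y = sysC s *m Xminus X + sysD s *m U.
Proof.
rewrite /Sigma_iso /= mul_block_col; split => [/eq_col_mx //|[{1}-> <-] //].
Qed.

(* Along the rank-one direction [v *m row_mx xi eta] the systems consistent with
   the data form a line of stable closed loops, so the trace [xi *m v] of the
   direction vanishes. *)
Lemma informative_state_independent (q : nat) (K : 'M[R]_q) (L : 'M[R]_(q, p))
    (M : 'M[R]_(m, q)) (s : system R n m p) (xi : 'rV[R]_n) (eta : 'rV[R]_m) :
  Sigma_iso U X Y s -> Sigma_iso U X Y `<=` Sigma_KLM K L M ->
  xi *m Xminus X + eta *m U = 0 -> xi = 0.
Proof.
move=> /Sigma_isoP [XE YE] sub ann.
pose dir (v : 'cV[R]_n) : 'M_(n + q) :=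
  block_mx (v *m xi) (v *m eta *m M) 0 0.
have st v a : stable (closed_loop s K L M + a *: dir v).
  pose s' := System (sysA s + a *: (v *m xi)) (sysB s + a *: (v *m eta))
                    (sysC s) (sysD s).
  have -> : closed_loop s K L M + a *: dir v = closed_loop s' K L M.
    rewrite /closed_loop /dir /= scale_block_mx add_block_mx !scaler0 !addr0.
    by rewrite mulmxDl -scalemxAl.
  apply: sub; apply/Sigma_isoP; split => //=.
  rewrite !mulmxDl -!scalemxAl addrACA -scalerDr -!(mulmxA v) -mulmxDr ann.
  by rewrite mulmx0 scaler0 addr0.
(* For [v] a unit vector the trace [xi *m v] is an entry of [xi]. *)
apply/rowP => i; have := stable_affine_trace (st (delta_mx i 0)).
rewrite mxtrace_block mxtrace0 addr0 mxtrace_mulC => tr0; rewrite mxE -tr0.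
rewrite /mxtrace big_ord1 mxE (bigD1 i) //= big1 => [|j /negPf neq_ji].
  by rewrite mxE !eqxx mulr1 addr0.
by rewrite mxE neq_ji mulr0.
Qed.

Variables (r : nat) (E : 'M[R]_(m, r)) (Uhat : 'M[R]_(r, N)).
Hypotheses (UE : U = E *m Uhat) (E_full : row_full E) (Uhat_free : row_free Uhat).

(** Since [pinvmx E] is a left inverse of [E], a relation between the rows of [Xminus X] and [Uhat]
    is one between those of [Xminus X] and [U], so its state part vanishes. *)
Lemma informative_row_free (q : nat) (K : 'M[R]_q) (L : 'M[R]_(q, p))
    (M : 'M[R]_(m, q)) (s : system R n m p) :
  Sigma_iso U X Y s -> Sigma_iso U X Y `<=` Sigma_KLM K L M ->
  row_free (col_mx (Xminus X) Uhat).
Proof.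
move=> sP sub; apply/inj_row_free => v; rewrite -[v]hsubmxK mul_row_col => ann.
have xi0 : lsubmx v = 0.
  apply: (informative_state_independent (eta := rsubmx v *m pinvmx E) sP sub).
  by rewrite UE -mulmxA (mulmxA (pinvmx E)) mulVpmx // mul1mx.
rewrite xi0 mul0mx add0r in ann; rewrite xi0.
by rewrite (row_free_inj Uhat_free (etrans ann (esym (mul0mx _ _)))) row_mx0.
Qed.

Variables (V1 : 'M[R]_(N, n)) (V2 : 'M[R]_(N, r)).
Hypothesis V_inv :
  col_mx (Xminus X) Uhat *m row_mx V1 V2 = block_mx 1%:M 0 0 1%:M.

(** The data fix [A] and [C], but [B] and [D] only on the range of [E]. *)
Lemma Sigma_iso_coef (s : system R n m p) : Sigma_iso U X Y s ->
  [/\ Xplus X *m V1 = sysA s, Xplus X *m V2 = sysB s *m E,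
      Y *m V1 = sysC s & Y *m V2 = sysD s *m E].
Proof.
move=> /Sigma_isoP [-> ->]; rewrite UE.
have := V_inv; rewrite mul_col_row => /eq_block_mx [XV1 XV2 UV1 UV2].
by rewrite !mulmxDl -!mulmxA XV1 XV2 UV1 UV2 !mulmx0 !mulmx1 !addr0 !add0r.
Qed.

(** The controller also stabilizes the consistent system [s'], whose [B] factors through [pinvmx E];
    its static feedback gain is therefore one for [Xplus X *m V2]. *)
Lemma informative_gains (s : system R n m p) :
  Sigma_iso U X Y s -> informative_iso U X Y ->
  (exists Mhat : 'M[R]_(r, n), stable (Xplus X *m (V1 + V2 *m Mhat))) /\
  (exists L : 'M[R]_(n, p), stable ((Xplus X - L *m Y) *m V1)).
Proof.
move=> sP [q [K [L [M sub]]]].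
have [AE BE CE DE] := Sigma_iso_coef sP.
pose s' := System (sysA s) (Xplus X *m V2 *m pinvmx E)
                  (sysC s) (Y *m V2 *m pinvmx E).
have pinvE w (W : 'M_(w, r)) : W *m pinvmx E *m U = W *m Uhat.
  by rewrite UE mulmxA -(mulmxA W) mulVpmx // mulmx1.
have st : stable (closed_loop s' K L M).
  apply: sub; apply/Sigma_isoP; have /Sigma_isoP [XE YE] := sP.
  by rewrite /= !pinvE BE DE -!mulmxA -UE.
split.
  move: st; rewrite /closed_loop /= -(mulmxA _ (pinvmx E)).
  move=> /dynamic_to_static [F stF]; exists F.
  by rewrite mulmxDr mulmxA AE.
(* Transposition exchanges the roles of [B *m M] and [L *m C], so the dual feedback gain gives the
   observer gain, up to sign. *)
move: st => /stable_trmx; rewrite tr_block_mx /= trmx_mul.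
move=> /dynamic_to_static [F /stable_trmx stF]; exists (- F^T).
by rewrite mulNmx opprK mulmxDl -mulmxA AE CE; rewrite linearD /= trmx_mul !trmxK in stF.
Qed.

(* In the coordinates [x - w], [w] the closed loop is block triangular. *)
Lemma observer_stabilizes (Mhat : 'M[R]_(r, n)) (L : 'M[R]_(n, p)) :
  stable (Xplus X *m (V1 + V2 *m Mhat)) ->
  stable ((Xplus X - L *m Y) *m V1) ->
  Sigma_iso U X Y `<=`
    Sigma_KLM ((Xplus X - L *m Y) *m (V1 + V2 *m Mhat)) L (E *m Mhat).
Proof.
move=> stM stL s sP; have [AE BE CE DE] := Sigma_iso_coef sP.
set A := sysA s in AE *; set B := sysB s in BE *.
set C := sysC s in CE *; set D := sysD s in DE *.
have AB : Xplus X *m (V1 + V2 *m Mhat) = A + B *m E *m Mhat.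
  by rewrite mulmxDr mulmxA AE BE.
have AC : (Xplus X - L *m Y) *m V1 = A - L *m C.
  by rewrite mulmxBl -mulmxA AE CE.
(* The feedthrough [L *m D *m M] cancels, leaving the usual observer matrix. *)
have KE : (Xplus X - L *m Y) *m (V1 + V2 *m Mhat) + L *m D *m (E *m Mhat) =
    A + B *m E *m Mhat - L *m C.
  rewrite mulmxBl AB -(mulmxA L Y) (mulmxDr Y) (mulmxA Y) CE DE mulmxDr.
  by rewrite opprD addrA !mulmxA subrK.
rewrite AB in stM; rewrite AC in stL.
(* [P] is its own inverse and sends the pair of states [x], [w] to [x], [x - w]. *)
pose P : 'M[R]_(n + n) := block_mx 1%:M 0 1%:M (- 1%:M).
have PP : P *m P = 1%:M.
  rewrite mulmx_block !(mul0mx, mulmx0, mul1mx, mulNmx, addr0, add0r, opprK).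
  by rewrite subrr -scalar_mx_block.
have [Pu _] := mulmx1_unit PP.
apply: (@stable_similar _ _
  (block_mx (A + B *m E *m Mhat) (- (B *m E *m Mhat)) 0 (A - L *m C)) _ P) => //.
  rewrite /closed_loop -/A -/B -/C -/D KE !mulmx_block.
  rewrite !(mul0mx, mulmx0, mul1mx, mulmx1, mulNmx, mulmxN, addr0, add0r, opprK).
  rewrite addrK mulmxA opprB; congr block_mx.
  by move: (B *m _ *m _) (L *m C) => F G; apply/matrixP => i j; rewrite !mxE; ring.
exact: stable_ublock.
Qed.
End InputStateOutput.

(** * Observability, controllability and Hankel windows *)

Lemma exprS_mx (F : fieldType) (n i : nat) (A : 'M[F]_n) : A ^+ i.+1 = A *m A ^+ i.
Proof. exact: exprS. Qed.

Lemma exprSr_mx (F : fieldType) (n i : nat) (A : 'M[F]_n) : A ^+ i.+1 = A ^+ i *m A.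
Proof. exact: exprSr. Qed.

(** The observability matrix of depth [l]; applied to transposes it also expresses
    controllability. *)
Definition obs (R : realType) (n p : nat) (l : nat) (A : 'M[R]_n) (C : 'M[R]_(p, n)) :
    'M[R]_(\sum_(i < l) p, n) :=
  \mxcol_(i < l) (C *m A ^+ i).

Lemma mxcol_subP (F : fieldType) (l q N r : nat) (f : 'I_l -> 'M[F]_(q, N))
    (W : 'M[F]_(r, N)) :
  reflect (forall i, f i <= W)%MS ((\mxcol_i f i <= W)%MS).
Proof.
rewrite eqmx_col; apply: (iffP sumsmx_subP) => [sub i | sub i _].
  by rewrite -(genmxE (f i)) sub.
by rewrite genmxE.
Qed.

Lemma obs_sub (R : realType) (n p l : nat) (A : 'M[R]_n) (C : 'M[R]_(p, n))
    (i : nat) : (i < l)%N -> (C *m A ^+ i <= obs l A C)%MS.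
Proof.
move=> lt_il; apply: (@mxcol_subP _ _ _ _ _ (fun j => C *m A ^+ j) _ _ (Ordinal lt_il)).
exact: submx_refl.
Qed.

(** Cayley-Hamilton, with the characteristic polynomial multiplied by a power of ['X] to reach
    degree [l], makes [C *m A ^+ l] a combination of the lower powers. *)
Lemma obs_stable (R : realType) (n p l : nat) (A : 'M[R]_n) (C : 'M[R]_(p, n)) :
  (n <= l)%N -> (obs l A C *m A <= obs l A C)%MS.
Proof.
case: n A C => [|n] A C le_nl.
  by rewrite (flatmx0 A) mulmx0 sub0mx.
rewrite {1}/obs mxcol_mul; apply/mxcol_subP => i.
rewrite -mulmxA -exprSr_mx.
have := ltn_ord i; rewrite leq_eqVlt => /orP [/eqP -> | ]; last exact: obs_sub.
have monicA := char_poly_monic A; have sizeA := size_char_poly A.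
set c := char_poly A in monicA sizeA.
have : horner_mx A ('X^(l - n.+1) * c) = 0.
  by rewrite rmorphM /= Cayley_Hamilton mulr0.
set q := 'X^_ * c; have size_q : size q = l.+1.
  by rewrite size_monicM ?monicXn ?monic_neq0 // size_polyXn sizeA; lia.
have monq : q \is monic by rewrite monicMr ?monicXn.
rewrite -[q]coefK size_q poly_def rmorph_sum big_ord_recr /=.
have -> : q`_l = 1 by have /monicP := monq; rewrite lead_coefE size_q.
rewrite scale1r rmorphXn /= horner_mx_X => /eqP; rewrite addrC addr_eq0 => /eqP ->.
rewrite mulmxN eqmx_opp mulmx_sumr; apply: summx_sub => j _.
rewrite linearZ /= rmorphXn /= horner_mx_X -scalemxAr scalemx_sub //.
exact: obs_sub.
Qed.

Lemma obs_stabilizes (R : realType) (n p k l : nat) (A : 'M[R]_n) (C : 'M[R]_(p, n)) :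
  (n <= k)%N -> (obs l A C <= obs k A C)%MS.
Proof.
move=> le_nk; case: k le_nk => [|k] le_nk.
  by apply/mxcol_subP => i; move: A C; case: n le_nk => // _ A C; rewrite thinmx0 sub0mx.
apply/mxcol_subP => -[i _] /=; elim: i => [|i IHi]; first exact: obs_sub.
rewrite exprSr_mx mulmxA; apply: submx_trans (obs_stable _ _ le_nk).
exact: submxMr.
Qed.

(** * Row spaces of input, state and output windows *)

Section Windows.
Context {R : realType} {n m p : nat}.
Variable s : system R n m p.
Variables (l N : nat).
Variables (X : nat -> 'M[R]_(n, N)) (U : nat -> 'M[R]_(m, N)) (Y : nat -> 'M[R]_(p, N)).

(** [N] trajectories run in parallel, one per column; they will be the shifts of a single one. *)
Definition window_trajectory : Prop := forall i, (i < l)%N ->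
  X i.+1 = sysA s *m X i + sysB s *m U i /\
  Y i = sysC s *m X i + sysD s *m U i.

Definition span_win (q : nat) (f : nat -> 'M[R]_(q, N)) (a d : nat) : 'M[R]_N :=
  (\sum_(i < d) <<f (a + i)%N>>)%MS.

Lemma sub_span_win (q : nat) (f : nat -> 'M[R]_(q, N)) a d i :
  (i < d)%N -> (f (a + i)%N <= span_win f a d)%MS.
Proof. by move=> lt_id; rewrite -genmxE (sumsmx_sup (Ordinal lt_id)). Qed.

Lemma span_winP (q r : nat) (f : nat -> 'M[R]_(q, N)) a d (W : 'M[R]_(r, N)) :
  (forall i, (i < d)%N -> f (a + i)%N <= W)%MS -> (span_win f a d <= W)%MS.
Proof. by move=> sub; apply/sumsmx_subP => i _; rewrite genmxE sub. Qed.

Lemma span_win_cat (q : nat) (f : nat -> 'M[R]_(q, N)) d e :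
  (span_win f 0 (d + e) <= span_win f 0 d + span_win f d e)%MS.
Proof.
apply: span_winP => i lt_i; have [lt_id | le_di] := ltnP i d.
  by apply: submx_trans (addsmxSl _ _); exact: sub_span_win.
apply: submx_trans (addsmxSr _ _); rewrite add0n -(subnKC le_di).
by apply: sub_span_win; rewrite ltn_subLR.
Qed.

Lemma rank_span_win (q : nat) (f : nat -> 'M[R]_(q, N)) a d :
  (\rank (span_win f a d) <= d * q)%N.
Proof.
rewrite -eqmx_col (leq_trans (rank_leq_row _)) // sum_nat_const card_ord //.
Qed.

Hypothesis traj : window_trajectory.

Lemma state_response a i : (a + i <= l)%N ->
  X (a + i)%N = sysA s ^+ i *m X a +
    \sum_(j < i) sysA s ^+ (i.-1 - j) *m sysB s *m U (a + j)%N.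
Proof.
elim: i => [|i IHi] le_l; first by rewrite addn0 expr0 mul1mx big_ord0 addr0.
rewrite addnS in le_l *; have [-> _] := traj le_l.
rewrite (IHi (ltnW le_l)) mulmxDr mulmxA exprS_mx -addrA; congr (_ + _).
rewrite big_ord_recr /= subnn expr0 mul1mx mulmx_sumr; congr (_ + _).
apply: eq_bigr => j _; rewrite !mulmxA -exprS_mx.
by congr (_ ^+ _ *m _ *m _); have := ltn_ord j; lia.
Qed.

Lemma state_response_sub a i : (a + i <= l)%N ->
  (X (a + i)%N - sysA s ^+ i *m X a <= span_win U a i)%MS.
Proof.
move=> /state_response ->; rewrite addrC addKr; apply: summx_sub => j _.
by rewrite mulmx_sub // sub_span_win.
Qed.

Lemma output_response_sub a i d : (i < d)%N -> (a + d <= l)%N ->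
  (Y (a + i)%N - sysC s *m sysA s ^+ i *m X a <= span_win U a d)%MS.
Proof.
move=> lt_id le_l; have lt_l : (a + i < l)%N by lia.
have [_ ->] := traj lt_l.
rewrite addrAC -mulmxA -mulmxBr addmx_sub // mulmx_sub ?sub_span_win //.
apply: submx_trans (state_response_sub (ltnW lt_l)) _.
by apply: span_winP => j lt_ji; apply: sub_span_win; lia.
Qed.

Lemma state_sub a i : (a + i <= l)%N ->
  (X (a + i)%N <= X a + span_win U a i)%MS.
Proof.
move=> /state_response_sub sub; rewrite -[X (a + i)%N](subrK (sysA s ^+ i *m X a)).
rewrite addmx_sub // ?(submx_trans sub) ?addsmxSr //.
by rewrite mulmx_sub // addsmxSl.
Qed.

Lemma output_sub a d : (a + d <= l)%N ->
  (span_win Y a d <= obs d (sysA s) (sysC s) *m X a + span_win U a d)%MS.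
Proof.
move=> le_l; apply: span_winP => i lt_id.
rewrite -[Y (a + i)%N](subrK (sysC s *m sysA s ^+ i *m X a)) addmx_sub //.
  by apply: submx_trans (addsmxSr _ _); apply: output_response_sub le_l.
by apply: submx_trans (addsmxSl _ _); apply: submxMr; apply: obs_sub.
Qed.

(** A left inverse of the observability matrix recovers [X a] from the outputs corrected by their
    input responses. *)
Lemma state_from_output a d : row_full (obs d (sysA s) (sysC s)) ->
  (a + d <= l)%N -> (X a <= span_win Y a d + span_win U a d)%MS.
Proof.
move=> full le_l; rewrite -[X a]mul1mx -(mulVpmx full) -mulmxA mulmx_sub //.
rewrite mxcol_mul; apply/mxcol_subP => i.
rewrite -(subKr (Y (a + i)%N) (_ *m X a)) addmx_sub //.
  by apply: submx_trans (addsmxSl _ _); exact: sub_span_win.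
rewrite eqmx_opp; apply: submx_trans (addsmxSr _ _).
exact: output_response_sub.
Qed.

Hypothesis rankUY : (l * m + n <= \rank (span_win U 0 l + span_win Y 0 l))%N.

(** The outputs add to the input span at most the rank of the observability matrix, and the data
    rank requires [n] more. *)
Lemma obs_full : row_full (obs l (sysA s) (sysC s)).
Proof.
rewrite -col_leq_rank.
have sub : (span_win U 0 l + span_win Y 0 l <=
            span_win U 0 l + obs l (sysA s) (sysC s) *m X 0%N)%MS.
  by rewrite addsmx_sub addsmxSl addsmxC output_sub.
rewrite -(leq_add2l (l * m)) (leq_trans rankUY) // (leq_trans (mxrankS sub)) //.
rewrite (leq_trans (mxrank_adds_leqif _ _)) // leq_add ?rank_span_win //.
exact: mxrankM_maxl.
Qed.

Lemma rank_state_input : (l * m + n <= \rank (X 0%N + span_win U 0 l))%N.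
Proof.
apply: leq_trans rankUY _; apply: mxrankS; rewrite addsmx_sub addsmxSr.
apply: submx_trans (output_sub _) _; rewrite ?add0n // addsmxS // mulmx_sub //.
Qed.
End Windows.

Lemma trmxX (F : fieldType) (n i : nat) (A : 'M[F]_n) : (A ^+ i)^T = A^T ^+ i.
Proof.
by elim: i => [|i IHi]; rewrite ?trmx1 // exprS_mx exprSr_mx trmx_mul IHi.
Qed.

(* The column space of the controllability matrix, here the row space of
   [obs k A^T B^T], carries a realization of the input-output map. *)
Lemma minimal_controllable (R : realType) (n m p k : nat) (s : system R n m p) :
  minimal s -> (n < k)%N -> row_full (obs k (sysA s)^T (sysB s)^T).
Proof.
move=> min_s lt_nk; set O := obs _ _ _.
have /submxP [A' AE] : (row_base O *m (sysA s)^T <= row_base O)%MS.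
  rewrite eq_row_base (submx_trans _ (obs_stable _ _ (ltnW lt_nk))) //.
  by rewrite submxMr // eq_row_base.
have /submxP [B' BE] : ((sysB s)^T <= row_base O)%MS.
  rewrite eq_row_base -[_^T]mulmx1; apply: (@obs_sub _ _ _ _ _ _ 0).
  exact: leq_ltn_trans lt_nk.
pose s' := System A'^T B'^T (sysC s *m (row_base O)^T) (sysD s).
rewrite -col_leq_rank; apply: (min_s _ s') => u x y x' y' x0 traj x'0 traj'.
have AE' : sysA s *m (row_base O)^T = (row_base O)^T *m A'^T.
  by rewrite -[sysA s]trmxK -!trmx_mul AE.
have BE' : sysB s = (row_base O)^T *m B'^T by rewrite -[sysB s]trmxK BE trmx_mul.
have xE t : x t = (row_base O)^T *m x' t.
  elim: t => [|t IHt]; first by rewrite x0 x'0 mulmx0.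
  have [-> _] := traj _ _ (ltnSn t); have [-> _] := traj' _ _ (ltnSn t).
  by rewrite IHt BE' /= mulmxDr !mulmxA AE'.
move=> t; have [_ ->] := traj _ _ (ltnSn t); have [_ ->] := traj' _ _ (ltnSn t).
by rewrite xE /= mulmxA.
Qed.

(** * Uniqueness of the state window up to an invertible factor *)

Section StateWindow.
Context {R : realType} {n m p N k : nat}.
Variables (U : nat -> 'M[R]_(m, N)) (Y : nat -> 'M[R]_(p, N)).
Hypothesis lt_nk : (n < k)%N.
Hypothesis rankUY :
  ((k + k) * m + n <= \rank (span_win U 0 (k + k) + span_win Y 0 (k + k)))%N.

Lemma rank_past_future (s : system R n m p) (X : nat -> 'M[R]_(n, N)) :
  window_trajectory s (k + k) X U Y ->
  ((k + k) * m + n <= \rank (X 0%N + span_win U 0 k + span_win U k k))%N.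
Proof.
move=> traj; apply: leq_trans (rank_state_input traj rankUY) _.
apply: mxrankS; rewrite -addsmxA; apply: addsmxS => //; exact: span_win_cat.
Qed.

(** The rank equals the total number [n + k * m + k * m] of generating rows, so no dimension is left
    for the intersection. *)
Lemma past_future_disjoint (s : system R n m p) (X : nat -> 'M[R]_(n, N)) :
  window_trajectory s (k + k) X U Y ->
  ((X 0%N + span_win U 0 k) :&: span_win U k k = 0)%MS.
Proof.
move=> /rank_past_future rk; apply/eqP; rewrite -mxrank_eq0 -leqn0.
have := mxrank_sum_cap (X 0%N + span_win U 0 k)%MS (span_win U k k).
have := mxrank_adds_leqif (X 0%N) (span_win U 0 k) => -[le1 _].
have := rank_span_win U 0 k; have := rank_span_win U k k.
have := rank_leq_row (X 0%N).
rewrite mulnDl in rk; move: rk le1.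
move: (\rank _) (\rank _) (\rank _) (\rank _) (\rank _) (\rank _).
lia.
Qed.

Lemma past_free (s : system R n m p) (X : nat -> 'M[R]_(n, N)) :
  window_trajectory s (k + k) X U Y ->
  row_free (col_mx (X 0%N) (\mxcol_(i < k) U i)).
Proof.
move=> /rank_past_future rk; rewrite -row_leq_rank -addsmxE.
have -> : \rank (X 0%N + \mxcol_(i < k) U i)%MS = \rank (X 0%N + span_win U 0 k)%MS.
  by apply/eqmx_rank/eqmxP/adds_eqmx => //; exact: eqmx_col.
rewrite sum_nat_const card_ord.
have := mxrank_adds_leqif (X 0%N + span_win U 0 k)%MS (span_win U k k) => -[le1 _].
have := rank_span_win U k k; rewrite mulnDl in rk; move: rk le1.
move: (\rank _) (\rank _) (\rank _); lia.
Qed.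

(** [X k] combines the free rows of [X 0] and the past inputs, so a row annihilating it annihilates
    every [A ^+ i *m B] with [i < k], and controllability applies. *)
Lemma state_free (s : system R n m p) (X : nat -> 'M[R]_(n, N)) :
  window_trajectory s (k + k) X U Y ->
  row_full (obs k (sysA s)^T (sysB s)^T) -> row_free (X k).
Proof.
move=> traj ctrb; apply/inj_row_free => xi.
have := state_response traj (a := 0) (i := k); rewrite add0n => ->; last exact: leq_addr.
rewrite (_ : _ + _ = row_mx (sysA s ^+ k)
    (\mxrow_(j < k) (sysA s ^+ (k.-1 - j) *m sysB s)) *m
    col_mx (X 0%N) (\mxcol_(j < k) U j)); last first.
  by rewrite mul_row_col mul_mxrow_mxcol.
rewrite mulmxA => xi0.
have := row_free_inj (past_free traj) (etrans xi0 (esym (mul0mx _ _))).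
rewrite mul_mx_row -row_mx0 => /eq_row_mx [_].
rewrite mul_mxrow -mxrow0 => /eq_mxrowP xiB.
suff : obs k (sysA s)^T (sysB s)^T *m xi^T = 0.
  by move=> O0; rewrite -[xi]trmxK -[xi^T]mul1mx -(mulVpmx ctrb) -mulmxA O0 mulmx0 trmx0.
rewrite mxcol_mul -mxcol0; apply/eq_mxcol => i.
rewrite -trmxX -!trmx_mul; have := xiB (rev_ord i).
by rewrite /= (_ : k.-1 - _ = i)%N => [->|]; rewrite ?trmx0 //; have := ltn_ord i; lia.
Qed.

(* The state window is determined by the future up to future inputs, and it lies
   in the past, which is independent of the future inputs. *)
Lemma state_le (s1 s2 : system R n m p) (X1 X2 : nat -> 'M[R]_(n, N)) :
  window_trajectory s1 (k + k) X1 U Y -> window_trajectory s2 (k + k) X2 U Y ->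
  (X2 k <= X1 k)%MS.
Proof.
move=> traj1 traj2.
(* Observability, known at depth [k + k], passes down to depth [k] because [n < k]. *)
have obs2 : row_full (obs k (sysA s2) (sysC s2)).
  rewrite -sub1mx; have /submx_full/submx_trans -> // := obs_full traj2 rankUY.
  exact: obs_stabilizes (ltnW lt_nk).
have Y_le a : (a + k <= k + k)%N -> (span_win Y a k <= X1 a + span_win U a k)%MS.
  move=> le_a; apply: submx_trans (output_sub traj1 le_a) _.
  by rewrite addsmxS // submxMl.
have X2_le a : (a + k <= k + k)%N -> (X2 a <= X1 a + span_win U a k)%MS.
  move=> le_a; apply: submx_trans (state_from_output traj2 obs2 le_a) _.
  by rewrite addsmx_sub Y_le //= addsmxSr.
have past1 : (X1 k <= X1 0%N + span_win U 0 k)%MS.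
  by have := state_sub traj1 (a := 0) (i := k); rewrite add0n; apply; rewrite leq_addr.
(* [X2 0] is recovered from past inputs and outputs, hence from the past of the first system. *)
have past2 : (X2 k <= X1 0%N + span_win U 0 k)%MS.
  have := state_sub traj2 (a := 0) (i := k); rewrite add0n leq_addr => /(_ isT).
  by move/submx_trans; apply; rewrite addsmx_sub addsmxSr X2_le // add0n leq_addr.
have /sub_addsmxP [[/= G H] X2E] := X2_le k (leqnn _).
(* This term is both a combination of future inputs and a difference of two elements of the past. *)
have H0 : H *m span_win U k k = 0.
  apply/eqP; rewrite -submx0 -(past_future_disjoint traj1) sub_capmx submxMl andbT.
  by rewrite -[_ *m _](addKr (G *m X1 k)) -X2E addrC addmx_sub // eqmx_opp mulmx_sub.
by rewrite X2E H0 addr0 submxMl.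
Qed.

(** The inclusion [state_le] used both ways gives equal row spaces; since [X1 k] is free, the factor
    is invertible. *)
Lemma state_similar (s1 s2 : system R n m p) (X1 X2 : nat -> 'M[R]_(n, N)) :
  window_trajectory s1 (k + k) X1 U Y -> window_trajectory s2 (k + k) X2 U Y ->
  row_full (obs k (sysA s1)^T (sysB s1)^T) ->
  exists2 P, P \in unitmx & X2 k = P *m X1 k.
Proof.
move=> traj1 traj2 /(state_free traj1) free1.
have /submxP [P PE] := state_le traj1 traj2.
exists P => //; rewrite -row_free_unit -row_leq_rank.
rewrite -(mxrankMfree P free1) -PE.
by rewrite (leq_trans _ (mxrankS (state_le traj2 traj1))) // row_leq_rank.
Qed.
End StateWindow.

(** * From trajectories to Hankel windows, and from input/output to input/state/output data *)

Section HankelWindows.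
Context {R : realType} {n m p : nat}.

Lemma trajectory_windows (s : system R n m p) (T l N : nat) u x y :
  trajectory s T u x y -> (l + N <= T.+1)%N ->
  window_trajectory s l (fun a => window x a N) (fun a => window u a N)
    (fun a => window y a N).
Proof.
move=> traj le_T a lt_al.
split; apply/matrixP => i j; have lt_T : (a + j < T)%N by have := ltn_ord j; lia.
  have [xE _] := traj _ lt_T; rewrite mxE addSn xE !mxE.
  by congr (_ + _); apply: eq_bigr => h _; rewrite !mxE.
have [_ yE] := traj _ lt_T; rewrite mxE yE !mxE.
by congr (_ + _); apply: eq_bigr => h _; rewrite !mxE.
Qed.

Lemma rank_hankel (T l : nat) (u : nat -> 'cV[R]_m) (y : nat -> 'cV[R]_p) :
  \rank (col_mx (hankel l T u) (hankel l T y)) =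
  \rank (span_win (fun a => window u a (T - l).+1) 0 l +
         span_win (fun a => window y a (T - l).+1) 0 l)%MS.
Proof.
rewrite -addsmxE; apply/eqmx_rank/eqmxP/adds_eqmx; exact: eqmx_col.
Qed.

Lemma Xplus_window (P : 'M[R]_n) (x : nat -> 'cV[R]_n) a N :
  Xplus (P *m window x a N.+1) = P *m window x a.+1 N.
Proof.
apply/matrixP => i j; rewrite !mxE; apply: eq_bigr => h _; rewrite !mxE.
by rewrite lift0 addnS.
Qed.

Lemma Xminus_window (P : 'M[R]_n) (x : nat -> 'cV[R]_n) a N :
  Xminus (P *m window x a N.+1) = P *m window x a N.
Proof.
apply/matrixP => i j; rewrite !mxE; apply: eq_bigr => h _; rewrite !mxE.
by rewrite lift_max.
Qed.

Definition change_state (P : 'M[R]_n) (s : system R n m p) : system R n m p :=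
  System (P *m sysA s *m invmx P) (P *m sysB s) (sysC s *m invmx P) (sysD s).

Lemma trajectory_Sigma_iso (s : system R n m p) (T a N : nat) u x y (P : 'M[R]_n) :
  P \in unitmx -> trajectory s T u x y -> (a + N <= T)%N ->
  Sigma_iso (window u a N) (P *m window x a N.+1) (window y a N) (change_state P s).
Proof.
move=> Pu traj le_T; apply/Sigma_isoP; rewrite Xplus_window Xminus_window /=.
have [|xE yE] := trajectory_windows (l := a.+1) (N := N) traj _ (ltnSn a); first lia.
by rewrite xE yE mulmxDr !mulmxA !mulmxKV.
Qed.

Lemma Sigma_io_trajectory (s : system R n m p) (T : nat) u y :
  Sigma_io n (window u 0 T) (window y 0 T) s -> exists x, trajectory s T u x y.
Proof.
(* Only times up to [T] matter, where [inord] is exact. *)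
move=> [X /Sigma_isoP [XE YE]]; exists (fun t => col (inord t) X) => t lt_tT.
have colM (q r : nat) (A : 'M[R]_(q, r)) (B : 'M_(r, T)) j :
  col j (A *m B) = A *m col j B by rewrite !colE mulmxA.
pose j := Ordinal lt_tT.
have winE q (f : nat -> 'cV[R]_q) : col j (window f 0 T) = f t.
  by apply/colP => i; rewrite !mxE.
have -> : col (inord t.+1) X = col j (Xplus X).
  by apply/colP => i; rewrite !mxE; congr (X _ _); apply/val_inj; rewrite /= inordK.
have -> : col (inord t) X = col j (Xminus X).
  apply/colP => i; rewrite !mxE; congr (X _ _); apply/val_inj.
  by rewrite /= /bump leqNgt lt_tT inordK // ltnW.
by rewrite XE -(winE _ y) YE !linearD /= !colM !winE.
Qed.

Lemma change_state_stable (q : nat) (K : 'M[R]_q) (L : 'M[R]_(q, p))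
    (M : 'M[R]_(m, q)) (P : 'M[R]_n) (s : system R n m p) :
  P \in unitmx -> stable (closed_loop (change_state P s) K L M) ->
  stable (closed_loop s K L M).
Proof.
move=> Pu; apply: (@stable_similar _ _ _ _ (block_mx P 0 0 1%:M)).
  by rewrite unitmxE det_ublock det1 mulr1 -unitmxE.
rewrite /closed_loop /= !mulmx_block.
rewrite !(mul0mx, mulmx0, mul1mx, mulmx1, addr0, add0r).
by rewrite mulmxKV // -!mulmxA mulVmx // mulmx1.
Qed.

(** The state window of a consistent system is [P] times that of [sys], so changing its state by
    [S *m invmx P] makes it consistent with the recovered state data; similarity preserves
    closed-loop stability. *)
Lemma Sigma_io_stabilized (T k : nat) (sys : system R n m p) u x y (S : 'M[R]_n)
    (q : nat) (K : 'M[R]_q) (L : 'M[R]_(q, p)) (M : 'M[R]_(m, q)) :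
  minimal sys -> trajectory sys T u x y ->
  (n < k)%N -> (2 * k < T)%N -> S \in unitmx ->
  \rank (col_mx (hankel (2 * k) T u) (hankel (2 * k) T y)) = (2 * k * m + n)%N ->
  Sigma_iso (window u k (T - 2 * k)) (S *m window x k (T - 2 * k).+1)
    (window y k (T - 2 * k)) `<=` Sigma_KLM K L M ->
  Sigma_io n (window u 0 T) (window y 0 T) `<=` Sigma_KLM K L M.
Proof.
move=> min_sys traj lt_nk lt_kT Su; rewrite rank_hankel.
have : (2 * k + (T - 2 * k) = T)%N by lia.
move: (T - 2 * k)%N => N TE rankH sub s /Sigma_io_trajectory [x' traj'].
rewrite mul2n -addnn in TE rankH.
have le_T : (k + k + N.+1 <= T.+1)%N by lia.
have [|P Pu x'E] := state_similar lt_nk _ (trajectory_windows traj le_T)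
    (trajectory_windows traj' le_T) (minimal_controllable min_sys lt_nk).
  by rewrite rankH.
have Qu : S *m invmx P \in unitmx by rewrite unitmx_mul Su unitmx_inv.
apply: (change_state_stable Qu); apply: sub.
rewrite (_ : S *m _ = S *m invmx P *m window x' k N.+1).
  by apply: (trajectory_Sigma_iso Qu traj'); lia.
by rewrite x'E mulmxA mulmxKV.
Qed.
End HankelWindows.

Theorem corollary41 (R : realType) (n m p T k : nat)
    (sys : system R n m p)
    (u : nat -> 'cV[R]_m) (x : nat -> 'cV[R]_n) (y : nat -> 'cV[R]_p)
    (S : 'M[R]_n) :
  minimal sys ->
  trajectory sys T u x y ->
  (n < k)%N -> (2 * k < T)%N ->
  S \in unitmx ->
  let U := window u 0 T in
  let Y := window y 0 T in
  let Ubar := window u k (T - 2 * k) in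
  let Ybar := window y k (T - 2 * k) in
  let Xbar := S *m window x k (T - 2 * k).+1 in
  \rank (col_mx (hankel (2 * k) T u) (hankel (2 * k) T y))
    = (2 * k * m + n)%N ->
  informative_iso Ubar Xbar Ybar ->
  informative_io n U Y /\
  (exists (r : nat) (E : 'M[R]_(m, r)) (Uhat : 'M[R]_(r, T - 2 * k)),
     [/\ Ubar = E *m Uhat, row_full E & row_free Uhat]) /\
  (forall (r : nat) (E : 'M[R]_(m, r)) (Uhat : 'M[R]_(r, T - 2 * k)),
     Ubar = E *m Uhat -> row_full E -> row_free Uhat ->
     (exists (V1 : 'M[R]_(T - 2 * k, n)) (V2 : 'M[R]_(T - 2 * k, r)),
        col_mx (Xminus Xbar) Uhat *m row_mx V1 V2
          = block_mx 1%:M 0 0 1%:M) /\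
     (forall (V1 : 'M[R]_(T - 2 * k, n)) (V2 : 'M[R]_(T - 2 * k, r)),
        col_mx (Xminus Xbar) Uhat *m row_mx V1 V2
          = block_mx 1%:M 0 0 1%:M ->
        (exists Mhat : 'M[R]_(r, n),
           stable (Xplus Xbar *m (V1 + V2 *m Mhat))) /\
        (exists L : 'M[R]_(n, p),
           stable ((Xplus Xbar - L *m Ybar) *m V1)) /\
        (forall (Mhat : 'M[R]_(r, n)) (L : 'M[R]_(n, p)),
           stable (Xplus Xbar *m (V1 + V2 *m Mhat)) ->
           stable ((Xplus Xbar - L *m Ybar) *m V1) ->
           let M := E *m Mhat in
           let K := (Xplus Xbar - L *m Ybar) *m (V1 + V2 *m Mhat) in
           Sigma_io n U Y `<=` Sigma_KLM K L M))).
Proof.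
move=> min_sys traj lt_nk lt_kT Su U Y Ubar Ybar Xbar rankH inf.
have io q K L M := @Sigma_io_stabilized _ _ _ _ T k sys u x y S q K L M
  min_sys traj lt_nk lt_kT Su rankH.
(* The data-generating system in the coordinates [S] provides the consistent system from which the
   trace argument starts. *)
have isoS : Sigma_iso Ubar Xbar Ybar (change_state S sys).
  by apply: trajectory_Sigma_iso Su traj _; lia.
split; first by have [q [K [L [M sub]]]] := inf; exists q, K, L, M; exact: io.
split.
  (* The rank factorization of [Ubar]. *)
  exists _, (col_base Ubar), (row_base Ubar).
  by rewrite mulmx_base col_base_full row_base_free.
move=> r E Uhat UE E_full Uhat_free; split.
  have [q [K [L [M sub]]]] := inf.
  have /row_freeP [V ZV] := informative_row_free UE E_full Uhat_free isoS sub.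
  by exists (lsubmx V), (rsubmx V); rewrite hsubmxK ZV scalar_mx_block.
move=> V1 V2 V_inv.
have [exM exL] := informative_gains UE E_full V_inv isoS inf.
split=> //; split=> // Mhat L stM stL M K; apply: io.
exact: (observer_stabilizes UE V_inv stM stL).
Qed.
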